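(* Let $G$ be an infinite connected simple graph with bounded degrees that is recurrent and vertex-transitive, and let $0\le p<p_T(G)$. Then $$\lim_{n\to\infty}\frac{\widetilde E^{p}[U_n]}{E[R_n]}=1.$$
   Context: $(S_n)_{n\ge0}$ is the simple random walk on $G$, and $P^x$ is its law started at $x$; $G$ is recurrent if this walk is recurrent. $\mathbb{P}_p$ is the law of Bernoulli bond percolation on $G$ with parameter $p$; $C_x$ is the open cluster of $x$. $p_T(G):=\inf\{p\in[0,1]:E^{\mathbb{P}_p}[|C_o|]=+\infty\}$ (independent of $o$). $\widetilde E^{p}$ is expectation with respect to $P^o\otimes\mathbb{P}_p$ and $E$ is expectation with respect to $P^o$, where $o$ is any fixed vertex (by vertex-transitivity the values do not depend on $o$). $R_n:=|\{S_0,\dots,S_n\}|$ and $U_n:=\big|\bigcup_{x\in\{S_0,\dots,S_n\}}C_x\big|$. *)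

(* Defs.v *)
From mathcomp Require Import all_boot all_order all_algebra finmap.
From mathcomp Require Import all_classical all_reals all_analysis.

Set Implicit Arguments.
Unset Strict Implicit.
Unset Printing Implicit Defensive.
Import Order.TTheory GRing.Theory Num.Theory.
Import numFieldNormedType.Exports.

Local Open Scope classical_set_scope.
Local Open Scope ring_scope.

(** * Simple graphs *)

(* [pointedType] only records that the vertex set is nonempty, which is what
   the library asks of the carrier of a measurable space. *)
Record simple_graph (V : pointedType) := SimpleGraph {
  adj :> rel V;
  adj_sym : symmetric adj;
  adj_irrefl : irreflexive adj }.

Definition linked (T : Type) (r : rel T) (x y : T) : Prop :=
  exists2 s : seq T, path r x s & last x s = y.

Section graph.
Context (V : pointedType) (G : simple_graph V).

Definition neighbors (x : V) : set V := [set y | G x y].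

Definition degree (x : V) : nat := #|` fset_set (neighbors x)|.

(* The junk value [degree x = 0] for an infinite neighborhood is ruled out
   here, since [#<= `I_D] forces finiteness. *)
Definition bounded_degree : Prop :=
  exists D : nat, forall x, (neighbors x #<= `I_D)%card.

Definition connected_graph : Prop := forall x y, linked G x y.

Definition automorphism (f : V -> V) : Prop :=
  bijective f /\ forall x y, G (f x) (f y) = G x y.

Definition vertex_transitive : Prop :=
  forall x y, exists2 f, automorphism f & f x = y.

(* An edge is the unordered pair of its endpoints; [edges] is used below as
   a type through the coercion from sets to types. *)
Definition edges : set (set V) := [set [set z.1; z.2] | z in [set z | G z.1 z.2]].

End graph.

(** * Simple random walk *)

Section walk.
Context (R : realType) (V : pointedType) (G : simple_graph V).

(* The product sigma-algebra on [nat -> V] for the discrete sigma-algebra on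
   [V]; generating by points suffices as the graphs considered, being
   connected and locally finite, are countable. *)
Definition trajectory_cylinders : set (set (nat -> V)) :=
  [set A | exists k v, A = [set S | S k = v]].

Definition trajectory := g_sigma_algebraType trajectory_cylinders.

Definition step_prob (x y : V) : R := if G x y then (degree G x)%:R^-1 else 0.

Definition srw_law (x : V) (P : probability trajectory R) : Prop :=
  forall (n : nat) (v : nat -> V),
    P [set S | forall k, (k <= n)%N -> S k = v k] =
    ((v 0%N == x)%:R * \prod_(k < n) step_prob (v k) (v k.+1))%:E.

Definition recurrent (P : V -> probability trajectory R) : Prop :=
  forall x, P x [set S | exists2 n, (0 < n)%N & S n = x] = 1%E.

Definition visited (n : nat) (S : trajectory) : set V :=
  [set S k | k in `I_n.+1].

End walk.

(** * Bernoulli bond percolation *)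

Section percolation.
Context (R : realType) (V : pointedType) (G : simple_graph V).

Definition config_cylinders : set (set (edges G -> bool)) :=
  [set A | exists e b, A = [set w | w e = b]].

Definition config := g_sigma_algebraType config_cylinders.

Definition bernoulli_percolation_law (p : R) (P : probability config R) :
    Prop :=
  forall (E : {fset edges G}) (b : edges G -> bool),
    P [set w | forall e, e \in E -> w e = b e] =
    (\prod_(e <- E) (if b e then p else 1 - p))%:E.

Definition open_adj (w : config) : rel V :=
  fun x y => `[< exists2 e : edges G, val e = [set x; y] & w e >].

Definition open_cluster (w : config) (x : V) : set V :=
  [set y | linked (open_adj w) x y].

(* [P] is meant as the family of percolation laws indexed by the parameter. *)
Definition p_T (P : R -> probability config R) (o : V) : R :=
  inf [set p | 0 <= p <= 1 /\
    (\int[P p]_w counting (open_cluster w o) = +oo)%E].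

End percolation.

(** * Expected sizes of the range and of the union of its clusters *)

Section expectations.
Context (R : realType) (V : pointedType) (G : simple_graph V).
Local Open Scope ereal_scope.

Definition mean_R (Po : probability (trajectory V) R) (n : nat) : \bar R :=
  \int[Po]_S counting (visited n S).

Definition mean_U (Po : probability (trajectory V) R)
    (Pp : probability (config G) R) (n : nat) : \bar R :=
  \int[Po \x Pp]_z counting (\bigcup_(x in visited n z.1) open_cluster z.2 x).

End expectations.

(* Main.v *)
(* Write [vis n] for the set of vertices visited up to time [n]. Transport a
   finite set [F] around [o] to a window [F x] around each [x] by automorphisms.
   A vertex [y] of the cluster of a visited [x] is in [vis (n + m)], or lies in
   the part of the cluster outside [F x], or lies in [F x] but is not visited
   within [m] steps after the first visit to [x]. By transitivity and the Markov
   property at that first visit,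
     E R_n <= E U_n <= E R_(n+m) + E R_n * c,
   where [c = E|C_o \ F| + E|F \ vis m|] starting from [o], and
   [E R_(n+m) <= E R_n + m]. Since [E|C_o|] is finite below [p_T] and a
   recurrent walk visits every vertex almost surely, choosing [F] and then [m]
   makes [c] small, while [m] is negligible because [E R_n] tends to infinity. *)
Require Import Defs.
From mathcomp Require Import all_boot all_order all_algebra finmap.
From mathcomp Require Import all_classical all_reals all_analysis.
From mathcomp Require Import measurable_realfun lra.
Set Implicit Arguments.
Unset Strict Implicit.
Unset Printing Implicit Defensive.
Import Order.TTheory GRing.Theory Num.Theory.
Import numFieldNormedType.Exports.
Local Open Scope classical_set_scope.
Local Open Scope ring_scope.

(** * Trajectories *)

(** Local finiteness keeps every ball around [point] countable, and connectedness makes these balls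
    exhaust [V]. *)
Lemma connected_countable (V : pointedType) (G : simple_graph V) :
  connected_graph G -> bounded_degree G -> countable [set: V].
Proof.
move=> Gconn [D Gbdd].
pose ball := fix ball n : set V :=
  if n is n.+1 then \bigcup_(x in ball n) neighbors G x else [set point].
have ballC n : countable (ball n).
  elim: n => [|n IHn] /=; first exact: countable1.
  apply: bigcup_countable => // x _; apply: finite_set_countable.
  by apply/finite_set_leP; exists D; exact: Gbdd.
suff -> : [set: V] = \bigcup_n ball n by exact: bigcup_countable.
apply/seteqP; split => // x _; have [s Gs <-] := Gconn point x.
exists (size s) => //; elim/last_ind: s Gs => [//|s z IHs].
rewrite rcons_path last_rcons size_rcons => /andP[/IHs Bs Gz].
by exists (last point s).
Qed.

(** The enumeration [e] lets sums over vertices be written as series indexed by [nat]. *)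
Lemma infinite_countable_bij (V : pointedType) :
    infinite_set [set: V] -> countable [set: V] ->
  exists (e : nat -> V) (g : V -> nat), cancel e g /\ cancel g e.
Proof.
move=> Vinf Vcount.
have /card_esym/pcard_eqP[f] : ([set: V] #= [set: nat])%card.
  by apply/card_eqPle; split => //; apply/infiniteP.
have [h fK hK] : bijective f by rewrite -setTT_bijective; exact: bij.
by exists f, h.
Qed.

Definition cylinder (V : pointedType) (n : nat) (v : nat -> V) :
  set (trajectory V) := [set S | forall k, (k <= n)%N -> S k = v k].

Section trajectories.
Context (V : pointedType) (e : nat -> V) (g : V -> nat) (gK : cancel g e).

(** A finite prefix is a list of vertex codes, hence coded by one natural number. This makes covers
    by cylinders of a given length countable. *)
Lemma prefix_enumeration : exists c : nat -> nat -> V,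
  forall (S : nat -> V) N, exists n, forall k, (k <= N)%N -> c n k = S k.
Proof.
exists (fun n k => e (nth 0%N (odflt [::] (choice.unpickle n)) k)) => S N.
pose s := [seq g (S i) | i <- iota 0 N.+1].
exists (choice.pickle s) => k kN; rewrite choice.pickleK /=.
by rewrite /s (nth_map 0%N) ?size_iota// nth_iota// gK.
Qed.

Lemma measurable_position k (v : V) :
  measurable ([set S | S k = v] : set (trajectory V)).
Proof. by apply: sub_sigma_algebra; exists k, v. Qed.

Lemma measurable_cylinder n (v : nat -> V) : measurable (cylinder n v).
Proof.
rewrite (_ : cylinder n v = \bigcap_(k in `I_n.+1) [set S | S k = v k]).
  by apply: bigcap_measurable => [|k _]; [exists 0%N|exact: measurable_position].
by apply/seteqP; split => S /=; exact.
Qed.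

(** The empty set is added for closure under intersection. The lower bound [N] on the length serves
    [markov], where cylinders shorter than the stopping time are avoided. *)
Let long_cylinders N : set (set (trajectory V)) :=
  set0 |` [set A | exists n v, (N <= n)%N /\ A = cylinder n v].

Lemma long_cylinders_setI N : setI_closed (long_cylinders N).
Proof.
move=> A B [->|[n [v [Nn ->]]]]; first by rewrite set0I; left.
case=> [->|[m [w [Nm ->]]]]; first by rewrite setI0; left.
have [[S [vS wS]]|] := pselect (cylinder n v `&` cylinder m w !=set0); last first.
  by move=> /set0P/negP/negPn/eqP ->; left.
right; exists (maxn n m), S; split; first by rewrite leq_max Nn.
apply/seteqP; split=> [S' [vS' wS'] k|S' SS'].
  by rewrite leq_max => /orP[] kn; [rewrite vS'// vS|rewrite wS'// wS].
by split=> k kn; rewrite SS' ?leq_max ?kn ?orbT//; [exact: vS|exact: wS].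
Qed.

Lemma long_cylinders_generate N :
  (@measurable _ (trajectory V)) = <<s long_cylinders N >>.
Proof.
apply/seteqP; split; last first.
  apply: smallest_sub; first exact: sigma_algebra_measurable.
  by move=> A [->|[n [v [_ ->]]]] //; exact: measurable_cylinder.
apply: smallest_sub; first exact: smallest_sigma_algebra.
move=> _ [k [v ->]]; have [c cP] := prefix_enumeration.
(* A prefix up to time [M] determines [S k] and is long enough to be an admissible cylinder. *)
pose M := maxn k N.
rewrite (_ : [set S | S k = v] = \bigcup_n
  (if `[< c n k = v >] then cylinder M (c n) else set0)); last first.
  apply/seteqP; split=> [S /= Sk|S [n _]].
    have [n cn] := cP S M; exists n => //; case: asboolP => [_ j jM|].
      by rewrite cn.
    by rewrite cn ?leq_maxl.
  by case: asboolP => // <- /(_ k); apply; rewrite leq_maxl.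
apply: (@bigcupT_measurable _ (g_sigma_algebraType (long_cylinders N))) => n.
case: asboolP => // _; apply: sub_sigma_algebra; right.
by exists M, (c n); rewrite leq_maxr.
Qed.

Lemma trajectory_measure_unique (R : realType) N
    (mu nu : {measure set (trajectory V) -> \bar R}) :
    (forall n v, (N <= n)%N -> mu (cylinder n v) = nu (cylinder n v)) ->
    (mu setT < +oo)%E ->
  forall A, measurable A -> mu A = nu A.
Proof.
move=> munu muoo; have [c cP] := prefix_enumeration.
apply: (@measure_unique _ _ _ (long_cylinders N) (fun n => cylinder N (c n))).
- exact: long_cylinders_generate.
- exact: long_cylinders_setI.
- by move=> n; right; exists N, (c n).
- apply/seteqP; split => // S _; have [n cn] := cP S N.
  by exists n => // k kN; rewrite cn.
- by move=> A [->|[n [v [Nn ->]]]]; [rewrite !measure0|exact: munu].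
- move=> n; apply: le_lt_trans muoo; apply: le_measure => //.
  by rewrite inE; exact: measurable_cylinder.
  by rewrite inE.
Qed.

End trajectories.

(** * Simple random walk *)

(** The existential form keeps the image measure opaque: later proofs see only its values. *)
Lemma pushforward_measure d d' (T : measurableType d) (U : measurableType d')
    (R : realType) (m : {measure set T -> \bar R}) (f : T -> U) :
    measurable_fun setT f ->
  exists mu : {measure set U -> \bar R}, forall A, mu A = m (f @^-1` A).
Proof. by move=> mf; unshelve eexists (pushforward m f). Qed.

Section simple_random_walk.
Context (R : realType) (V : pointedType) (G : simple_graph V).
Context (e : nat -> V) (g : V -> nat) (gK : cancel g e).
Context (P : V -> probability (trajectory V) R).
Hypothesis P_law : forall x, srw_law G x (P x).

Definition shift (k : nat) (S : trajectory V) : trajectory V :=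
  fun j => S (k + j)%N.

Definition stopped (k : nat) (S : trajectory V) : trajectory V :=
  fun j => S (minn j k).

Lemma measurable_fun_trajectory d (T : measurableType d)
    (f : T -> trajectory V) :
  (forall k v, measurable [set t | f t k = v]) -> measurable_fun setT f.
Proof.
move=> mf; apply: (@measurability _ _ T (trajectory V) setT f (@trajectory_cylinders V)) => //.
by move=> _ [_ [j [v ->]] <-]; rewrite setTI; exact: mf.
Qed.

Lemma measurable_shift k : measurable_fun setT (shift k).
Proof.
by apply: measurable_fun_trajectory => j v; exact: measurable_position.
Qed.

Lemma measurable_stopped k : measurable_fun setT (stopped k).
Proof.
by apply: measurable_fun_trajectory => j v; exact: measurable_position.
Qed.

Lemma measurable_shift_preimage k (B : set (trajectory V)) :
  measurable B -> measurable (shift k @^-1` B).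
Proof. by move=> mB; rewrite -[X in measurable X]setTI; exact: measurable_shift. Qed.

Lemma cylinderE x n v : P x (cylinder n v) =
  ((v 0%N == x)%:R * \prod_(k < n) step_prob R G (v k) (v k.+1))%:E.
Proof. exact: P_law. Qed.

Lemma step_prob_ge0 x y : 0 <= step_prob R G x y.
Proof. by rewrite /step_prob; case: ifP. Qed.

(** Both sides are finite measures in [B], so cylinders suffice; there the product of step
    probabilities along the concatenated path splits at time [k]. *)
Lemma markov_cylinder x k v (B : set (trajectory V)) : measurable B ->
  (P x (cylinder k v `&` shift k @^-1` B) = P x (cylinder k v) * P (v k) B)%E.
Proof.
move=> mB; have mC := measurable_cylinder k v.
have q_ge0 : 0 <= (v 0%N == x)%:R *
    \prod_(i < k) step_prob R G (v i) (v i.+1).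
  by rewrite mulr_ge0// prodr_ge0// => i _; exact: step_prob_ge0.
have [mu muE] := pushforward_measure (mrestr (P x) mC) (measurable_shift k).
pose nu := mscale (NngNum q_ge0) (P (v k)).
have -> : P x (cylinder k v `&` shift k @^-1` B) = mu B.
  by rewrite muE /= /mrestr setIC.
suff -> : mu B = nu B by rewrite /nu /mscale /= cylinderE.
apply: (trajectory_measure_unique gK (N := 0%N)) mB; last first.
  rewrite muE /= /mrestr (@le_lt_trans _ _ 1%E) ?ltry//.
  by apply: probability_le1; rewrite preimage_setT setTI.
move=> m w _; rewrite muE /= /mrestr /nu /mscale /= cylinderE.
have [wv|wv] := eqVneq (w 0%N) (v k); last first.
  rewrite mul0r mule0 (_ : _ `&` _ = set0) ?measure0//.
  apply/seteqP; split => // S [/(_ 0%N (leq0n _)) + /(_ k (leqnn _)) Sk].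
  by rewrite /shift addn0 Sk => vw; rewrite vw eqxx in wv.
(* The concatenation of [v] and [w]; the two agree at the junction because [w 0 = v k]. *)
pose u i := if (i <= k)%N then v i else w (i - k)%N.
have uw i : u (k + i)%N = w i.
  rewrite /u; case: i => [|i]; first by rewrite addn0 leqnn wv.
  by rewrite -[leqRHS]addn0 leq_add2l/= addKn.
rewrite (_ : _ `&` _ = cylinder (k + m) u); last first.
  apply/seteqP; split => [S [wS vS] i ikm|S uS].
    rewrite /u; case: leqP => [ik|ki]; first exact: vS.
    by rewrite -wS ?leq_subLR// /shift subnKC// ltnW.
  split => i im; first by rewrite /shift uS ?leq_add2l.
  by rewrite uS ?(leq_trans im) ?leq_addr// /u im.
rewrite cylinderE -EFinM big_split_ord/= {1}/u leq0n mul1r -mulrA; congr (_ * (_ * _))%:E.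
  by apply: eq_bigr => i _; rewrite /u ltnW// ltn_ord.
by apply: eq_bigr => i _; rewrite -addnS !uw.
Qed.

(* The two measures below are compared after stopping the trajectory at time
   [k], so that cylinders of length at least [k] become cylinders of length
   exactly [k] and [A], being determined by the past, is unchanged. *)
Lemma markov x k z (A B : set (trajectory V)) :
    measurable A -> stopped k @^-1` A = A -> measurable B ->
  (P x (A `&` [set S | S k = z] `&` shift k @^-1` B) =
   P x (A `&` [set S | S k = z]) * P z B)%E.
Proof.
move=> mA Ak mB; have mz := measurable_position k z.
have mD := measurableI _ _ mz (measurable_shift_preimage k mB).
have [mu muE] := pushforward_measure (mrestr (P x) mD) (measurable_stopped k).
have [nu0 nu0E] := pushforward_measure (mrestr (P x) mz) (measurable_stopped k).
pose nu := mscale (NngNum (fine_ge0 (measure_ge0 (P z) B))) nu0.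
transitivity (mu A); first by rewrite muE /= /mrestr Ak setIA.
transitivity (nu A); last first.
  rewrite /nu /mscale /= fineK ?fin_num_measure// muleC.
  by rewrite nu0E /= /mrestr Ak.
apply: (trajectory_measure_unique gK (N := k)) mA; last first.
  rewrite muE /= /mrestr (@le_lt_trans _ _ 1%E) ?ltry//.
  by apply: probability_le1; rewrite preimage_setT setTI.
move=> n v kn; rewrite muE /= /mrestr /nu /mscale /= nu0E /= /mrestr.
rewrite fineK ?fin_num_measure// muleC.
have vS S : cylinder n v (stopped k S) -> cylinder k v S.
  by move=> vS j jk; rewrite -vS ?(leq_trans jk)// /stopped (minn_idPl jk).
(* A stopped trajectory is constant from time [k] on, so a prefix [v] that moves later has an empty
   preimage. *)
have [vk|vk] := pselect (forall j, (j <= n)%N -> v (minn j k) = v j); last first.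
  have S0 : stopped k @^-1` cylinder n v = set0.
    apply/seteqP; split => // S /[dup] /vS vS' vS0; apply: vk => j jn.
    by rewrite -(vS0 j jn) /stopped vS'// geq_minr.
  by rewrite S0 !set0I !measure0 mul0e.
have -> : stopped k @^-1` cylinder n v = cylinder k v.
  apply/seteqP; split => S; first exact: vS.
  by move=> vS' j jn; rewrite /stopped vS' ?geq_minr// vk.
have [vz|vz] := eqVneq (v k) z.
  have Cz : cylinder k v `<=` [set S | S k = z] by move=> S /(_ k (leqnn _)) /= ->.
  by rewrite setIA (setIidl Cz) -vz markov_cylinder.
have S0 : cylinder k v `&` [set S | S k = z] = set0.
  by apply/seteqP; split => // S [/(_ k (leqnn _)) Sk /=]; rewrite Sk; exact/eqP.
by rewrite setIA S0 set0I !measure0 mul0e.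
Qed.

End simple_random_walk.

Lemma neighbors_finite (V : pointedType) (G : simple_graph V) x :
  bounded_degree G -> finite_set (neighbors G x).
Proof. by case=> D Gbdd; apply/finite_set_leP; exists D; exact: Gbdd. Qed.

Lemma degree_automorphism (V : pointedType) (G : simple_graph V) (f : V -> V) x :
  bounded_degree G -> automorphism G f -> degree G (f x) = degree G x.
Proof.
move=> Gbdd [[h fK hK] fG]; rewrite /degree.
have -> : neighbors G (f x) = f @` neighbors G x.
  apply/seteqP; split => [y Gy|_ [y Gy <-]]; last by rewrite /neighbors /= fG.
  by exists (h y); rewrite ?hK// /neighbors/= -fG hK.
rewrite fset_set_image; last exact: neighbors_finite.
by rewrite card_imfset//; exact: can_inj fK.
Qed.

(** * Invariance of the walk under automorphisms and almost sure visits to every vertex *)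

Section recurrent_walk.
Context (R : realType) (V : pointedType) (G : simple_graph V).
Context (e : nat -> V) (g : V -> nat) (gK : cancel g e).
Context (P : V -> probability (trajectory V) R).
Hypothesis P_law : forall x, srw_law G x (P x).
Hypothesis Gbdd : bounded_degree G.
Hypothesis Gconn : connected_graph G.

(** Automorphisms preserve adjacency and degrees, hence the step probabilities and the law of every
    cylinder. *)
Lemma walk_automorphism (f : V -> V) x (A : set (trajectory V)) :
    automorphism G f -> measurable A ->
  P (f x) A = P x [set S | A (f \o S)].
Proof.
move=> fG mA; have [[h fK hK] fadj] := fG.
pose F (S : trajectory V) : trajectory V := f \o S.
have mF : measurable_fun setT F.
  apply: measurable_fun_trajectory => k v.
  rewrite (_ : [set _ | _] = [set S | S k = h v]); first exact: measurable_position.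
  by apply/seteqP; split => S /=; rewrite /F /=; [move=> <-; rewrite fK|move=> ->; rewrite hK].
have [mu muE] := pushforward_measure (P x) mF.
rewrite -[RHS]muE; apply: (trajectory_measure_unique gK (N := 0%N)) mA; last first.
  by rewrite (@le_lt_trans _ _ 1%E) ?ltry//; exact: probability_le1.
move=> n v _; rewrite muE (_ : _ @^-1` _ = cylinder n (h \o v)); last first.
  apply/seteqP; split => S vS k kn.
    by rewrite /= -(vS k kn) /F /= fK.
  by rewrite /F /= vS//= hK.
rewrite /= !(cylinderE P_law); congr ((_ * _)%:E).
  by rewrite -[in RHS](inj_eq (can_inj fK)) /= hK.
apply: eq_bigr => k _; rewrite /step_prob /= -[in RHS]fadj !hK.
by rewrite -[in LHS](hK (v k)) (degree_automorphism _ Gbdd fG) hK.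
Qed.

Lemma measurable_visited n y : measurable [set S : trajectory V | visited n S y].
Proof.
rewrite (_ : [set _ | _] = \bigcup_(k in `I_n.+1) [set S | S k = y]) //.
by apply: bigcup_measurable => k _; exact: measurable_position.
Qed.

Lemma start_elsewhere_null x y : y != x -> P x [set S | S 0%N = y] = 0%E.
Proof.
move=> yx; rewrite (_ : [set _ | _] = cylinder 0 (fun=> y)); last first.
  apply/seteqP; split => S /=; last exact.
  by move=> Sy k; rewrite leqn0 => /eqP ->.
by rewrite (cylinderE P_law) (negbTE yx) mul0r.
Qed.

Lemma not_at_start_null x : P x [set S | S 0%N <> x] = 0%E.
Proof.
have mx := measurable_position 0 x.
have -> : [set S : trajectory V | S 0%N <> x] = ~` [set S | S 0%N = x] by [].
rewrite probability_setC// (_ : [set _ | _] = cylinder 0 (fun=> x)); last first.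
  apply/seteqP; split => S /=; last exact.
  by move=> Sy k; rewrite leqn0 => /eqP ->.
by rewrite (cylinderE P_law) eqxx big_ord0 mulr1 subee.
Qed.

Definition avoids (y : V) : set (trajectory V) := [set S | forall k, S k <> y].

Lemma measurable_avoids y : measurable (avoids y).
Proof.
rewrite (_ : avoids y = \bigcap_k ~` [set S | S k = y]).
  by apply: bigcapT_measurable => k; apply: measurableC; exact: measurable_position.
by apply/seteqP; split => S yS k; have := yS k => //; exact.
Qed.

Hypothesis Grec : recurrent P.

(** Recurrence is stated as return to the starting point. The property is propagated along a path
    from [y] to [x]: if the walk from [w] hits [y] almost surely, then so does the walk from a
    neighbor [z] of [w], since [w] steps to [z] with positive probability. *)
Lemma avoids_null x y : P x (avoids y) = 0%E.
Proof.
have mav := measurable_avoids y.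
pose avoids1 : set (trajectory V) := shift 1 @^-1` avoids y.
have mav1 : measurable avoids1 by exact: measurable_shift_preimage.
have [s Gs <-] := Gconn y x; elim/last_ind: s Gs => [_|s z IHs] /=.
  apply/eqP; rewrite -measure_le0 -(not_at_start_null y).
  apply: le_measure; rewrite ?inE//; last by move=> S /(_ 0%N).
  exact: (measurableC (measurable_position 0 y)).
rewrite rcons_path last_rcons => /andP[/IHs {IHs}]; set w := last y s => w0 Gwz.
(* For [w = y] this is recurrence itself; for [w] distinct from [y], time 0 almost surely
   contributes no visit, and the induction hypothesis applies. *)
have av10 : P w avoids1 = 0%E.
  have [wy|wy] := eqVneq w y.
    rewrite wy; have := Grec y.
    set A : set (trajectory V) := [set S | _] => PA1; have AE : avoids1 = ~` A.
      apply/seteqP; split => [S yS [[//|n] _ Sy]|S yS n Sn]; first exact: (yS n).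
      by apply: yS; exists n.+1.
    have mA : measurable A by rewrite -[A]setCK -AE; exact: measurableC.
    by rewrite AE probability_setC// PA1 subee.
  apply/eqP; rewrite -measure_le0.
  have mw : measurable [set S : trajectory V | S 0%N = y] by exact: measurable_position.
  apply: (@le_trans _ _ (P w (avoids y `|` [set S | S 0%N = y]))).
    apply: le_measure; rewrite ?inE//; first exact: measurableU.
    move=> S yS; have [S0|S0] := pselect (S 0%N = y); [by right|left].
    by case=> [//|k]; exact: yS.
  have : (P w (avoids y `|` [set S | S 0%N = y]) <=
          P w (avoids y) + P w [set S | S 0%N = y])%E by exact: measureU2.
  by rewrite w0 start_elsewhere_null ?adde0// eq_sym.
pose v (i : nat) := if i is 0%N then w else z.
have step_gt0 : (0 < P w (cylinder 1 v))%E.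
  rewrite (cylinderE P_law) big_ord1 eqxx mul1r lte_fin /step_prob Gwz.
  rewrite invr_gt0 ltr0n cardfs_gt0; apply/fset0Pn; exists z.
  by rewrite in_fset_set ?inE//; exact: neighbors_finite.
have /esym := markov_cylinder gK P_law w 1 v mav.
have -> : P w (cylinder 1 v `&` shift 1 @^-1` avoids y) = 0%E.
  apply/eqP; rewrite -measure_le0 -av10; apply: le_measure; rewrite ?inE//.
  by apply: measurableI => //; exact: measurable_cylinder.
by move=> /eqP; rewrite mule_eq0 gt_eqF//= => /eqP.
Qed.

(** Continuity from above: the events decrease to [avoids y], which is null. *)
Lemma unvisited_cvg0 x y :
  P x [set S | ~ visited m S y] @[m --> \oo] --> (0 : \bar R)%E.
Proof.
rewrite -(avoids_null x y).
have -> : avoids y = \bigcap_m [set S : trajectory V | ~ visited m S y].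
  apply/seteqP; split => [S yS m _ [k _]|S yS k Sk]; first exact: yS.
  by apply: (yS k I); exists k => /=.
apply: nonincreasing_cvg_mu.
- by rewrite (le_lt_trans (probability_le1 _ _)) ?ltry//; exact: (measurableC (measurable_visited _ y)).
- by move=> m; exact: (measurableC (measurable_visited _ y)).
- by apply: bigcapT_measurable => m; exact: (measurableC (measurable_visited _ y)).
- move=> m n mn; apply/subsetPset => S yS [k /= km Sk]; apply: yS.
  by exists k => //=; exact: leq_trans km _.
Qed.

End recurrent_walk.

(** * Percolation *)

Section percolation.
Context (R : realType) (V : pointedType) (G : simple_graph V).

Lemma edge_of_adj x y : G x y -> exists a : edges G, val a = [set x; y].
Proof.
move=> Gxy; have xyG : [set x; y] \in edges G by rewrite inE; exists (x, y).
by exists (SigSub xyG).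
Qed.

(** An unordered pair determines its endpoints up to a swap; the degenerate cases would produce a
    loop. *)
Lemma adj_of_edge (a : edges G) x y : val a = [set x; y] -> G x y.
Proof.
have [[u v] /= Guv <-] := set_valP a => uvxy.
have [xu yu] : [set u; v] x /\ [set u; v] y by rewrite uvxy; split; [left|right].
have [ux vx] : [set x; y] u /\ [set x; y] v by rewrite -uvxy; split; [left|right].
case: xu yu => /= [xu|xv] [yu|yv].
- by case: vx Guv => /= ->; rewrite ?xu ?yu adj_irrefl.
- by rewrite xu yv.
- by rewrite xv yu adj_sym.
- by case: ux Guv => /= ->; rewrite ?xv ?yv adj_irrefl.
Qed.

Definition config_cylinder (E : {fset edges G}) (b : edges G -> bool) :
  set (config G) := [set w | forall a, a \in E -> w a = b a].

Lemma measurable_edge_state a b : measurable ([set w | w a = b] : set (config G)).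
Proof. by apply: sub_sigma_algebra; exists a, b. Qed.

Lemma measurable_config_cylinder E b : measurable (config_cylinder E b).
Proof.
rewrite (_ : config_cylinder E b = \bigcap_(a in [set` E]) [set w | w a = b a]) //.
by apply: fin_bigcap_measurable => // a _; exact: measurable_edge_state.
Qed.

Let cylinders : set (set (config G)) :=
  set0 |` [set A | exists E b, A = config_cylinder E b].

Lemma config_cylinders_setI : setI_closed cylinders.
Proof.
move=> A B [->|[E [b ->]]]; first by rewrite set0I; left.
case=> [->|[E' [b' ->]]]; first by rewrite setI0; left.
have [[w [bw b'w]]|] := pselect (config_cylinder E b `&` config_cylinder E' b' !=set0);
  last by move=> /set0P/negP/negPn/eqP ->; left.
right; exists (E `|` E')%fset, w; apply/seteqP; split => [w' [bw' b'w'] a|w' ww'].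
  by rewrite in_fsetU => /orP[] aE; [rewrite bw'// bw|rewrite b'w'// b'w].
by split => a aE; rewrite ww' ?in_fsetU ?aE ?orbT//; [exact: bw|exact: b'w].
Qed.

(** The finite cylinders form a generating pi-system, and the cylinder over no edge is the whole
    space. *)
Lemma config_measure_unique (mu nu : {measure set (config G) -> \bar R}) :
    (forall E b, mu (config_cylinder E b) = nu (config_cylinder E b)) ->
    (mu setT < +oo)%E ->
  forall A, measurable A -> mu A = nu A.
Proof.
move=> munu muoo; apply: (@measure_unique _ _ _ cylinders (fun=> setT)) => //.
- apply/seteqP; split; last first.
    apply: smallest_sub; first exact: sigma_algebra_measurable.
    by move=> A [->|[E [b ->]]] //; exact: measurable_config_cylinder.
  apply: smallest_sub; first exact: smallest_sigma_algebra.
  move=> _ [a [b ->]]; apply: sub_sigma_algebra; right.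
  exists [fset a]%fset, (fun=> b); apply/seteqP; split => w /=.
    by move=> wa a'; rewrite inE => /eqP ->.
  by apply; rewrite inE.
- exact: config_cylinders_setI.
- move=> _; right; exists fset0, (fun=> true).
  by apply/seteqP; split => // w _ a; rewrite inE.
- by rewrite bigcup_const.
- by move=> A [->|[E [b ->]]]; [rewrite !measure0|exact: munu].
Qed.

Context (e : nat -> V) (g : V -> nat) (gK : cancel g e).

Lemma measurable_open_adj x y : measurable [set w : config G | open_adj w x y].
Proof.
have [[a axy]|na] := pselect (exists a : edges G, val a = [set x; y]); last first.
  rewrite (_ : [set _ | _] = set0) //; apply/seteqP; split => // w /asboolP[a axy _].
  by apply: na; exists a.
rewrite (_ : [set _ | _] = [set w | w a = true]); first exact: measurable_edge_state.
apply/seteqP; split => [w /asboolP[a' a'xy]|w wa].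
  by rewrite (_ : a' = a) //; apply: val_inj; rewrite axy.
by apply/asboolP; exists a.
Qed.

(** Open paths are sorted by length; induction on the length takes a countable union over the first
    vertex reached. *)
Lemma measurable_open_cluster x y :
  measurable [set w : config G | open_cluster w x y].
Proof.
pose L n x := [set w : config G |
  exists s : seq V, [/\ size s = n, path (open_adj w) x s & last x s = y]].
rewrite (_ : [set _ | _] = \bigcup_n L n x); last first.
  apply/seteqP; split => [w [s xs sy]|w [n _ [s [_ xs sy]]]]; last by exists s.
  by exists (size s) => //; exists s.
apply: bigcupT_measurable => n; elim: n x => [|n IHn] x.
  have [->|xy] := eqVneq x y.
    rewrite (_ : L _ _ = setT) //; apply/seteqP; split => // w _.
    by exists [::].
  rewrite (_ : L _ _ = set0) //; apply/seteqP; split => // w [s []].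
  by move=> /size0nil -> _ /= /eqP; rewrite (negbTE xy).
rewrite (_ : L _ _ = \bigcup_i ([set w | open_adj w x (e i)] `&` L n (e i))).
  apply: bigcupT_measurable => i; apply: measurableI (IHn _).
  exact: measurable_open_adj.
apply/seteqP; split => w; last first.
  by move=> [i _ [xi [s [sn xs sy]]]]; exists (e i :: s); rewrite /= sn xi.
move=> [[|z s] [//= [sn] /andP[xz zs] sy]].
by exists (g z) => //; rewrite gK; split => //; exists s.
Qed.

Lemma open_adj_comp (h : V -> V) (F : edges G -> edges G) :
  automorphism G h -> (forall a, val (F a) = h @` val a) ->
  forall (w : config G) x y, open_adj (w \o F : config G) x y = open_adj w (h x) (h y).
Proof.
move=> [[h' hK h'K] hG] FE w x y; apply/asboolP/asboolP => -[a axy wa].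
  by exists (F a) => //; rewrite FE axy image_setU !image_set1.
have [b bxy] : exists b : edges G, val b = [set x; y].
  by apply: edge_of_adj; rewrite -hG; exact: adj_of_edge axy.
exists b => //=; rewrite (_ : F b = a) //; apply: val_inj.
by rewrite /= FE bxy axy image_setU !image_set1.
Qed.

(** The automorphism acts on edges by an injection [F]. Pulling configurations back along [F]
    preserves the product law and turns the cluster of [h x] into that of [x]. *)
Lemma open_cluster_automorphism (p : R) (P : probability (config G) R) h x y :
    bernoulli_percolation_law p P -> automorphism G h ->
  P [set w | open_cluster w (h x) (h y)] = P [set w | open_cluster w x y].
Proof.
move=> P_law hG; have [[h' hK h'K] hadj] := hG.
have /boolp.choice[F FE] (a : edges G) : exists b : edges G, val b = h @` val a.
  have [[u v] /= Guv auv] := set_valP a.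
  have [b bE] : exists b : edges G, val b = [set h u; h v].
    by apply: edge_of_adj; rewrite hadj.
  have aE : val a = [set u; v] := esym auv.
  by exists b; rewrite bE aE image_setU !image_set1.
have F_inj : injective F.
  have imK (A : set V) : h' @` (h @` A) = A.
    rewrite image_comp (_ : h' \o h = id) ?image_id//.
    by apply/funext => z; exact: hK.
  by move=> a b Fab; apply: val_inj; rewrite -[val a]imK -FE Fab FE imK.
pose T (w : config G) : config G := w \o F.
have mT : measurable_fun setT T.
  apply: (@measurability _ _ _ (config G) setT T (@config_cylinders V G)) => //.
  by move=> _ [_ [a [b ->]] <-]; rewrite setTI; exact: (measurable_edge_state (F a) b).
have [mu muE] := pushforward_measure P mT.
have muP E b : mu (config_cylinder E b) = P (config_cylinder E b).
  (* The pattern [b] carried along [F]; its value [false] outside the image of [F] is never read. *)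
  rewrite muE; pose b' a' := `[< exists2 a, F a = a' & b a >].
  have b'F a : b' (F a) = b a.
    by apply/asboolP/idP => [[a' /F_inj ->]|ba] //; exists a.
  rewrite (_ : _ @^-1` _ = config_cylinder (F @` E)%fset b'); last first.
    apply/seteqP; split => [w bw _ /imfsetP[a /= aE ->]|w b'w a aE].
      by rewrite b'F -(bw a aE).
    by rewrite /T /= b'w ?b'F//; apply/imfsetP; exists a.
  rewrite [LHS]P_law [RHS]P_law big_imfset /=; last by move=> *; exact: F_inj.
  by congr (_%:E); apply: eq_bigr => a _; rewrite b'F.
have muoo : (mu setT < +oo)%E.
  rewrite muE preimage_setT; apply: le_lt_trans (ltry 1); exact: probability_le1.
rewrite -[RHS](config_measure_unique muP muoo (measurable_open_cluster x y)).
rewrite muE; congr (P _); apply/seteqP.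
have TE w := open_adj_comp hG FE w.
split => w /= [s ws sy].
  exists (map h' s); last by rewrite -(hK x) last_map sy hK.
  rewrite -{1}(hK x) path_map; apply: sub_path ws => u v.
  by move=> uv; rewrite /= TE !h'K.
exists (map h s); last by rewrite last_map sy.
by rewrite path_map; apply: sub_path ws => u v; rewrite TE.
Qed.


End percolation.

(** * Expected cardinals *)

Section expected_cardinal.
Context (R : realType) (V : pointedType) (e : nat -> V) (g : V -> nat).
Hypotheses (eK : cancel e g) (gK : cancel g e).
Local Open Scope ereal_scope.

(** Moves the count to [nat], where counting measure is a series of Dirac masses. *)
Lemma counting_preimage (A : set V) :
  counting (e @^-1` A) = counting A :> \bar R.
Proof.
have AE : A = e @` (e @^-1` A).
  apply/seteqP; split => [x Ax|_ [i Ai <-]//].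
  by exists (g x); rewrite /= gK.
rewrite /counting; case: asboolP => finA; last first.
  rewrite asboolF// => finA'; apply: finA.
  by apply: finite_preimage => // i j _ _; exact: (can_inj eK).
rewrite [in RHS]AE asboolT; last exact: finite_image.
by rewrite fset_set_image// card_imfset//; exact: can_inj eK.
Qed.

(** Linearity of expectation: the cardinal is the sum of the indicators of membership, and Tonelli
    exchanges sum and integral. *)
Lemma expected_counting d (T : measurableType d)
    (mu : {measure set T -> \bar R}) (A : T -> set V) :
    (forall y, measurable [set t | A t y]) ->
  \int[mu]_t counting (A t) = \sum_(i <oo) mu [set t | A t (e i)].
Proof.
move=> mA; transitivity (\int[mu]_t \sum_(i <oo) (\1_[set t | A t (e i)] t)%:E).
  apply: eq_integral => t _; rewrite -counting_preimage counting_dirac.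
  apply: eq_eseriesr => i _; rewrite diracE indicE.
  suff -> : (i \in e @^-1` A t) = (t \in [set t | A t (e i)]) by [].
  by apply/idP/idP; rewrite !inE.
rewrite integral_nneseries//; last first.
  by move=> i; apply/measurable_EFinP; exact: measurable_indic.
by apply: eq_eseriesr => i _; rewrite integral_indic// setIT.
Qed.

(** Nonnegative series are unordered sums, which any permutation of the indices leaves unchanged. *)
Lemma nneseries_vertex_bij (a : V -> \bar R) (f : V -> V) :
    bijective f -> (forall x, 0 <= a x) ->
  \sum_(i <oo) a (e i) = \sum_(i <oo) a (f (e i)).
Proof.
move=> [h fK hK] a0; rewrite !nneseries_esumT//.
rewrite (@reindex_esum _ _ _ setT setT (g \o f \o e)).
  by apply: eq_esum => i _ /=; rewrite gK.
rewrite setTT_bijective; exists (g \o h \o e) => i /=.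
  by rewrite gK fK eK.
by rewrite gK hK eK.
Qed.

End expected_cardinal.

(** * The Markov property at the first visit to a vertex *)

Section first_visit.
Context (R : realType) (V : pointedType) (G : simple_graph V).
Context (e : nat -> V) (g : V -> nat) (gK : cancel g e).
Context (P : V -> probability (trajectory V) R).
Hypothesis P_law : forall x, srw_law G x (P x).
Local Open Scope ereal_scope.

Definition not_before (k : nat) (x : V) : set (trajectory V) :=
  [set S | forall j, (j < k)%N -> S j <> x].

Definition first_visit (k : nat) (x : V) : set (trajectory V) :=
  not_before k x `&` [set S | S k = x].

Lemma measurable_not_before k x : measurable (not_before k x).
Proof.
rewrite (_ : not_before k x = \bigcap_(j in `I_k) ~` [set S | S j = x]) //.
apply: bigcap_measurableType => j _; apply: measurableC.
exact: measurable_position.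
Qed.

Lemma measurable_first_visit k x : measurable (first_visit k x).
Proof.
by apply: measurableI; [exact: measurable_not_before|exact: measurable_position].
Qed.

Lemma first_visit_exists n (S : trajectory V) x :
  visited n S x -> exists2 k, (k <= n)%N & first_visit k x S.
Proof.
move=> [k /= kn Sk]; have ex : exists k, S k == x by exists k; exact/eqP.
case: (ex_minnP ex) => i /eqP Si imin; exists i.
  by rewrite (leq_trans (imin k _))//; exact/eqP.
by split => // j ji /eqP /imin; rewrite leqNgt ji.
Qed.

Lemma trivIset_first_visit x : trivIset setT (first_visit ^~ x).
Proof.
move=> i j _ _ [S [[Si Six] [Sj Sjx]]].
by case: (ltngtP i j) => // [/Sj|/Si].
Qed.

(** The hitting time is decomposed over its values [k]: a union bound, the Markov property at each
    fixed [k], and disjointness of the first-visit events to sum them back. *)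
Lemma first_visit_markov o x n (B : set (trajectory V)) : measurable B ->
  P o (\big[setU/set0]_(k < n.+1) (first_visit k x `&` shift k @^-1` B)) <=
  P o [set S | visited n S x] * P x B.
Proof.
move=> mB.
have mF k : measurable (first_visit k x `&` shift k @^-1` B).
  by apply: measurableI (measurable_first_visit k x) _; exact: measurable_shift_preimage.
apply: (le_trans (Boole_inequality (P o) (fun i _ => mF i))).
rewrite (eq_bigr (fun k : 'I_n.+1 => P o (first_visit k x) * P x B)); last first.
  move=> k _; apply: markov => //; first exact: measurable_not_before.
  apply/seteqP; split => S /= Sx j jk; have := Sx j jk;
    by rewrite /stopped (minn_idPl (ltnW jk)).
rewrite -ge0_sume_distrl// lee_wpmul2r//.
have <- := measure_bigsetU (P o) (measurable_first_visit ^~ x)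
  (@trivIset_first_visit x) n.+1.
apply: le_measure; rewrite ?inE.
- by apply: bigsetU_measurable => k _; exact: measurable_first_visit.
- exact: measurable_visited.
- rewrite -(bigcup_mkord n.+1 (first_visit ^~ x)) => S [k kn [_ Sk]].
  by exists k.
Qed.

End first_visit.

(** * Bounds relating the expected range and the expected union of clusters *)

Section expected_union.
Context (R : realType) (V : pointedType) (G : simple_graph V).
Context (e : nat -> V) (g : V -> nat).
Hypotheses (eK : cancel e g) (gK : cancel g e).
Context (P : V -> probability (trajectory V) R) (Q : probability (config G) R).
Hypothesis P_law : forall x, srw_law G x (P x).
Context (o : V).
Local Open Scope ereal_scope.

Lemma mean_RE n : mean_R (P o) n = \sum_(i <oo) P o [set S | visited n S (e i)].
Proof. by apply: expected_counting eK gK _ _ _ _ _ => y; exact: measurable_visited. Qed.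

Lemma measurable_union_event n y :
  measurable [set z : trajectory V * config G |
    (\bigcup_(x in visited n z.1) open_cluster z.2 x) y].
Proof.
rewrite (_ : [set _ | _] = \bigcup_i ([set S | visited n S (e i)] `*`
    [set w | open_cluster w (e i) y])).
  apply: bigcupT_measurable => i; apply: measurableX; first exact: measurable_visited.
  exact: measurable_open_cluster.
apply/seteqP; split => [z [x xz zy]|z [i _ [iz zy]]]; last by exists (e i).
by exists (g x); rewrite ?gK//; split; rewrite /= gK.
Qed.

Lemma mean_UE n : mean_U (P o) Q n = \sum_(i <oo) (P o \x Q)
  [set z | (\bigcup_(x in visited n z.1) open_cluster z.2 x) (e i)].
Proof.
by apply: expected_counting eK gK _ _ _ _ _ => y; exact: measurable_union_event.
Qed.

Lemma walk_event_prob (A : set (trajectory V)) : measurable A ->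
  (P o \x Q) (A `*` setT) = P o A.
Proof.
move=> mA; rewrite product_measure1E// -[RHS]mule1; congr (_ * _).
exact: probability_setT.
Qed.

(** Each visited vertex lies in its own cluster, through the empty path. *)
Lemma mean_R_le_mean_U n : mean_R (P o) n <= mean_U (P o) Q n.
Proof.
rewrite mean_RE mean_UE; apply: lee_nneseries => // i _.
have mv := measurable_visited n (e i).
rewrite -(walk_event_prob mv).
apply: le_measure; rewrite ?inE.
- exact: measurableX.
- exact: measurable_union_event.
- by move=> z [zi _]; exists (e i) => //; exists [::].
Qed.

(** Each further step adds at most one new vertex. *)
Lemma mean_R_addn n m : mean_R (P o) (n + m) <= mean_R (P o) n + m%:R%:E.
Proof.
elim: m => [|m IHm]; first by rewrite addn0 adde0.
rewrite addnS -natr1 EFinD addeA; apply: le_trans (leeD2r _ IHm).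
have mpos y : measurable [set S : trajectory V | y = S (n + m).+1].
  rewrite (_ : [set _ | _] = [set S | S (n + m).+1 = y]).
    exact: measurable_position.
  by apply/seteqP; split => S /= ->.
(* This series is the expected cardinal of the singleton formed by the new position. *)
have <- : \sum_(i <oo) P o [set S | e i = S (n + m).+1] = 1.
  transitivity (\int[P o]_S counting [set S (n + m).+1]).
    exact/esym/(expected_counting eK gK (P o) (A := fun S => [set S (n + m).+1]) mpos).
  rewrite -[RHS](@probability_setT _ _ _ (P o)) -[RHS]mul1e -integral_cst//.
  apply: eq_integral => S _; rewrite /counting asboolT ?fset_set1 ?cardfs1//.
rewrite !mean_RE -nneseriesD//; apply: lee_nneseries => // i _.
have mv := measurable_visited (n + m) (e i).
have mp := mpos (e i).
apply: le_trans (measureU2 (P o) mv mp); apply: le_measure; rewrite ?inE.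
- exact: measurable_visited.
- exact: measurableU.
- move=> S [k /=]; rewrite ltnS leq_eqVlt => /orP[/eqP -> Sk|kn Sk]; first by right.
  by left; exists k.
Qed.

(* [F x] is a window around [x]: the vertices of the cluster of [x] are split
   into those outside [F x], bounded by percolation, and those inside [F x],
   which the walk is likely to visit within [m] steps after reaching [x]. *)
Lemma mean_U_le (F : V -> set V) n m :
  mean_U (P o) Q n <= mean_R (P o) (n + m) +
    \sum_(j <oo) \sum_(i <oo) P o [set S | visited n S (e j)] *
      (if `[< F (e j) (e i) >] then P (e j) [set S | ~ visited m S (e i)]
       else Q [set w | open_cluster w (e j) (e i)]).
Proof.
(* With the sum over the covered vertex outermost, the comparison is made for each [y]
   separately. *)
rewrite mean_RE mean_UE nneseries_interchange; last first.
  by move=> j i; apply: mule_ge0 => //; case: ifP.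
rewrite -nneseriesD//; last first.
  by move=> i _ _; apply: nneseries_ge0 => j _ _; apply: mule_ge0 => //; case: ifP.
apply: lee_nneseries => // i _; set y := e i.
(* [D x] collects the outcomes where [x] is charged for a vertex [y] of its cluster that is
   unvisited by time [n + m]. *)
pose D x : set (trajectory V * config G) := if `[< F x y >] then
    (\big[setU/set0]_(k < n.+1) (first_visit k x `&`
      shift k @^-1` [set S | ~ visited m S y])) `*` setT
  else [set S | visited n S x] `*` [set w | open_cluster w x y].
have mNv : measurable [set S : trajectory V | ~ visited m S y].
  exact: measurableC (measurable_visited m y).
have mB x : measurable (\big[setU/set0]_(k < n.+1) (first_visit k x `&`
      shift k @^-1` [set S | ~ visited m S y])).
  apply: bigsetU_measurable => k _; apply: measurableI.
    exact: measurable_first_visit.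
  exact: measurable_shift_preimage.
have mD x : measurable (D x).
  rewrite /D; case: asboolP => _; apply: measurableX => //.
    exact: measurable_visited.
  exact: measurable_open_cluster.
have mv := measurable_visited (n + m) y.
pose E : set (trajectory V * config G) := [set S | visited (n + m) S y] `*` setT.
have mE : measurable E by exact: measurableX.
have mU : measurable (\bigcup_j D (e j)) by exact: bigcupT_measurable.
have DP x : (P o \x Q) (D x) <= P o [set S | visited n S x] *
    (if `[< F x y >] then P x [set S | ~ visited m S y]
     else Q [set w | open_cluster w x y]).
  rewrite /D; case: asboolP => _.
    by rewrite walk_event_prob//; exact: first_visit_markov.
  rewrite product_measure1E//; first exact: measurable_visited.
  exact: measurable_open_cluster.
have EP : (P o \x Q) E = P o [set S | visited (n + m) S y].
  exact: walk_event_prob.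
apply: (@le_trans _ _ ((P o \x Q) (E `|` \bigcup_j D (e j)))).
  apply: le_measure; rewrite ?inE; [exact: measurable_union_event|exact: measurableU|].
  move=> [S w] [x /= Sx wxy].
  have [vy|nvy] := pselect (visited (n + m) S y); [by left|right].
  exists (g x) => //; rewrite gK /D; case: asboolP => Fxy; last by split.
  split => //=; rewrite -(bigcup_mkord n.+1 (fun k => first_visit k x `&`
      shift k @^-1` [set S | ~ visited m S y])).
  have [k kn Sk] := first_visit_exists Sx; exists k => //; split => //.
  (* A visit to [y] within [m] steps of the first visit to [x], at time [k <= n], would happen by
     time [n + m]. *)
  move=> [j /= jm Sj]; apply: nvy; exists (k + j)%N => //=.
  by rewrite ltnS leq_add.
apply: (le_trans (measureU2 (P o \x Q) mE mU)); apply: leeD; first by rewrite -EP.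
apply: (@le_trans _ _ (\sum_(j <oo) (P o \x Q) (D (e j)))).
  by apply: measure_sigma_subadditive.
by apply: lee_nneseries => // j _; exact: DP.
Qed.

End expected_union.

(** * Choice of the window and of the waiting time *)

Lemma cvge0_near_le (R : realType) (u : (\bar R)^nat) (eps : R) :
    0 < eps -> u @ \oo --> (0 : \bar R)%E ->
  \forall n \near \oo, (u n <= eps%:E)%E.
Proof.
move=> eps0 /fine_cvgP[fin /cvgrPdist_le/(_ _ eps0) small].
near=> n; have finn : u n \is a fin_num by near: n.
rewrite -(fineK finn) lee_fin (le_trans (ler_norm _))// -normrN -sub0r.
by near: n.
Unshelve. all: by end_near.
Qed.

Section recurrent_transitive.
Context (R : realType) (V : pointedType) (G : simple_graph V).
Context (e : nat -> V) (g : V -> nat).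
Hypotheses (eK : cancel e g) (gK : cancel g e).
Context (P : V -> probability (trajectory V) R) (Q : probability (config G) R).
Context (p : R) (o : V).
Hypothesis P_law : forall x, srw_law G x (P x).
Hypothesis Q_law : bernoulli_percolation_law p Q.
Hypothesis Gbdd : bounded_degree G.
Hypothesis Gconn : connected_graph G.
Hypothesis Grec : recurrent P.

Lemma unvisited_sum_small K (eps : R) : 0 < eps ->
  \forall m \near \oo,
    (\sum_(0 <= i < K) P o [set S | ~ visited m S (e i)] <= eps%:E)%E.
Proof.
elim: K eps => [|K IHK] eps eps0.
  by near=> m; rewrite big_geq// lee_fin ltW.
have eps20 : 0 < eps / 2 by rewrite divr_gt0.
have small := cvge0_near_le eps20
  (unvisited_cvg0 gK P_law Gbdd Gconn Grec o (e K)).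
near=> m; rewrite big_nat_recr//= (splitr eps) EFinD; apply: leeD.
  by near: m; exact: IHK.
by near: m.
Unshelve. all: by end_near.
Qed.

(** The range is a singleton at time 0 and grows by at most one vertex per step. *)
Lemma mean_R_fin_num n : mean_R (P o) n \is a fin_num.
Proof.
rewrite ge0_fin_numE; last first.
  by rewrite (mean_RE eK gK)//; exact: nneseries_ge0.
rewrite -[n]add0n (le_lt_trans (mean_R_addn eK gK P o 0 n))//.
rewrite lte_add_pinfty ?ltry//.
rewrite /mean_R (eq_integral (cst 1%E)); last first.
  move=> S _ /=; rewrite (_ : visited 0 S = [set S 0%N]).
    by rewrite /counting asboolT ?fset_set1 ?cardfs1//; exact: finite_set1.
  apply/seteqP; split => [y [[|//] _ <-]//|_ ->]; by exists 0%N.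
by rewrite integral_cst// mul1e (le_lt_trans (probability_le1 _ _)) ?ltry.
Qed.

(** Among the first [K.+1] enumerated vertices, the expected number still unvisited is eventually at
    most 1, so at least [K] are visited on average. *)
Lemma mean_R_cvg_pinfty (B : R) :
  \forall n \near \oo, (B%:E <= mean_R (P o) n)%E.
Proof.
pose K := (Num.truncn `|B|).+1.
have BK : B <= K%:R by rewrite (le_trans (ler_norm B))// ltW// truncnS_gt.
near=> n; rewrite (@le_trans _ _ K%:R%:E)// -(@leeD2rE _ 1%E)//.
have visit_sum : (\sum_(0 <= i < K.+1) P o [set S | visited n S (e i)] +
    \sum_(0 <= i < K.+1) P o [set S | ~ visited n S (e i)] = K%:R%:E + 1)%E.
  rewrite -big_split/= (eq_bigr (fun=> 1%E)); last first.
    move=> i _; rewrite -[[set S | ~ _]]/(~` [set S | visited n S (e i)]).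
    rewrite probability_setC; last exact: measurable_visited.
    rewrite addeC subeK//; apply: fin_num_measure; exact: measurable_visited.
  by rewrite sumEFin sumr_const_nat subn0 -EFinD natr1.
rewrite -visit_sum; apply: leeD; last by near: n; exact: unvisited_sum_small.
by rewrite (mean_RE eK gK); exact: nneseries_lim_ge.
Unshelve. all: by end_near.
Qed.

Hypothesis Gtrans : vertex_transitive G.

(** The window around [o] consists of the first [K] enumerated vertices. By transitivity the cost of
    a visited vertex is the same everywhere, so [c] factors out and leaves the expected range. *)
Lemma mean_U_le_scaled K n m (c : R) :
    (\sum_(i <oo) (if (i < K)%N then P o [set S | ~ visited m S (e i)]
                   else Q [set w | open_cluster w o (e i)]) <= c%:E)%E ->
  (mean_U (P o) Q n <=
   mean_R (P o) n + m%:R%:E + mean_R (P o) n * c%:E)%E.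
Proof.
move=> sum_le_c.
have c0 : 0 <= c.
  rewrite -lee_fin; apply: le_trans sum_le_c.
  by apply: nneseries_ge0 => i _ _; case: ifP.
(* One automorphism [h x] per vertex carries [o] to [x], and its image of the window around [o] is
   the window [F x]. *)
have /boolp.choice[h hP] x : exists f, automorphism G f /\ f o = x.
  by have [f fG fo] := Gtrans o x; exists f.
pose F x : set V := [set h x (e i) | i in `I_K].
apply: (le_trans (mean_U_le eK gK Q P_law o F n m)).
apply: leeD; first exact: mean_R_addn.
rewrite (mean_RE eK gK).
have sumE x : (\sum_(i <oo) (if `[< F x (e i) >]
    then P x [set S | ~ visited m S (e i)]
    else Q [set w | open_cluster w x (e i)]) =
  \sum_(i <oo) (if (i < K)%N then P o [set S | ~ visited m S (e i)]
                else Q [set w | open_cluster w o (e i)]))%E.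
  (* Reindexing the series by [h x] brings each term back to the corresponding term at [o]. *)
  have [hG hx] := hP x; have [h_bij _] := hG; have h_inj := bij_inj h_bij.
  rewrite (nneseries_vertex_bij eK gK (a := fun y => if `[< F x y >]
    then P x [set S | ~ visited m S y] else Q [set w | open_cluster w x y])
    h_bij); last by move=> y; case: ifP.
  apply: eq_eseriesr => i _.
  have -> : `[< F x (h x (e i)) >] = (i < K)%N.
    apply/asboolP/idP => [[j jK /h_inj/(can_inj eK) <-]|iK]; first by [].
    by exists i.
  move: (h x) hG hx h_inj {h_bij} => f fG <- f_inj; case: ifP => _.
    rewrite (walk_automorphism gK P_law Gbdd _ fG); last first.
      exact: (measurableC (measurable_visited m _)).
    congr (P o _); apply/seteqP; split => S nv [k km Sk]; apply: nv;
      exists k => //=; first by rewrite Sk.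
    exact: f_inj.
  exact: (open_cluster_automorphism gK o (e i) Q_law fG).
apply: (@le_trans _ _ (\sum_(j <oo) (c%:E * P o [set S | visited n S (e j)]))%E).
  apply: lee_nneseries => [j _ _|j _].
    by apply: nneseries_ge0 => i _ _; apply: mule_ge0 => //; case: ifP.
  have Pfin : P o [set S | visited n S (e j)] \is a fin_num.
    by apply: fin_num_measure; exact: measurable_visited.
  rewrite -[X in (\sum_(_ <oo) (X * _))%E](fineK Pfin) nneseriesZl; last first.
    by move=> i _; case: ifP.
  by rewrite fineK// sumE muleC lee_wpmul2r.
by rewrite nneseriesZl// muleC.
Qed.

(** [K] is chosen first, from the tail of the convergent series for the expected cluster size, then
    [m] for these [K] vertices. The constant is [M = m], uniform in [n]. *)
Lemma mean_U_le_eps (eps : R) : 0 < eps ->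
    (\sum_(i <oo) Q [set w | open_cluster w o (e i)] < +oo)%E ->
  exists M : R, forall n, (mean_U (P o) Q n <=
    mean_R (P o) n + M%:E + mean_R (P o) n * eps%:E)%E.
Proof.
move=> eps0 Qoo; have eps20 : 0 < eps / 2 by rewrite divr_gt0.
have [K _ /(_ K (leqnn K)) tailK] :=
  cvge0_near_le eps20 (nneseries_tail_cvg Qoo (fun _ _ => measure_ge0 _ _)).
have [m _ /(_ m (leqnn m)) headK] := unvisited_sum_small K eps20.
exists m%:R => n; apply: (@mean_U_le_scaled K).
rewrite (@nneseries_split _ _ 0 K); last by move=> k _; case: ifP.
rewrite (splitr eps) EFinD add0n; apply: leeD.
  apply: le_trans headK; rewrite !big_mkord le_eqVlt; apply/orP; left.
  by apply/eqP; apply: eq_bigr => i _; rewrite ltn_ord.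
rewrite -nneseries_addn; last by move=> i; case: ifP.
rewrite -nneseries_addn// in tailK; apply: le_trans tailK.
apply: lee_nneseries => [i _ _|i _]; first by case: ifP.
by rewrite ltnNge leq_addl.
Qed.

End recurrent_transitive.

(** * Passage to the limit of the ratio *)

Theorem theorem1p7 (R : realType) (V : pointedType) (G : simple_graph V)
    (Pwalk : V -> probability (trajectory V) R)
    (Pperc : R -> probability (config G) R) (o : V) (p : R)
    (Vinf : infinite_set [set: V])
    (Gconn : connected_graph G)
    (Gbdd : bounded_degree G)
    (Gtrans : vertex_transitive G)
    (walk_law : forall x, srw_law G x (Pwalk x))
    (perc_law : forall q, 0 <= q <= 1 -> bernoulli_percolation_law q (Pperc q))
    (Grec : recurrent Pwalk)
    (p_ge0 : 0 <= p) (p_lt : p < p_T Pperc o) :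
  (mean_U (Pwalk o) (Pperc p) n / mean_R (Pwalk o) n)%E @[n --> \oo]
    --> (1 : \bar R)%E.
Proof.
have [e [g [eK gK]]] := infinite_countable_bij Vinf (connected_countable Gconn Gbdd).
move: p_lt; rewrite /p_T; set A := [set q | _] => p_ltA.
(* The infimum of the empty set is 0 by convention, which would contradict [0 <= p < inf A]. *)
have [q Aq] : A !=set0.
  by apply/set0P/eqP => A0; move: p_ltA; rewrite A0 inf0 ltNge p_ge0.
have infA a : A a -> inf A <= a.
  by move=> Aa; apply: ge_inf => //; exists 0 => b [/andP[]].
have p01 : 0 <= p <= 1.
  have /andP[_ q1] := Aq.1.
  by rewrite p_ge0 (le_trans (ltW p_ltA))// (le_trans (infA q Aq)).
have Qlaw := perc_law p p01.
set Q := Pperc p in Qlaw *.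
(* An infinite expected cluster size would put [p] in [A], whence [inf A <= p]. *)
have Qoo : (\sum_(i <oo) Q [set w | open_cluster w o (e i)] < +oo)%E.
  rewrite -(expected_counting eK gK Q (measurable_open_cluster gK o)).
  rewrite ltey; apply/eqP => Qoo.
  by have := infA p (conj p01 Qoo); rewrite leNgt p_ltA.
have UP eps (eps0 : 0 < eps) :=
  mean_U_le_eps eK gK walk_law Qlaw Gbdd Gconn Grec Gtrans eps0 Qoo.
have finR n := mean_R_fin_num eK gK Pwalk o n.
have finU n : mean_U (Pwalk o) Q n \is a fin_num.
  have [M UM] := UP 1 ltr01; rewrite ge0_fin_numE; last first.
    by rewrite (mean_UE eK gK) nneseries_ge0.
  by rewrite (le_lt_trans (UM n))// -(fineK (finR n)) -EFinM -!EFinD ltry.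
have RU n := mean_R_le_mean_U eK gK Pwalk Q o n.
pose r n := fine (mean_R (Pwalk o) n); pose u n := fine (mean_U (Pwalk o) Q n).
have rE n : mean_R (Pwalk o) n = (r n)%:E by rewrite fineK.
have uE n : mean_U (Pwalk o) Q n = (u n)%:E by rewrite fineK.
have r_ge B : \forall n \near \oo, B <= r n.
  near=> n; rewrite -lee_fin -rE; near: n.
  exact: (mean_R_cvg_pinfty eK gK o walk_law Gbdd Gconn Grec).
have ratioE : \forall n \near \oo,
    (mean_U (Pwalk o) Q n / mean_R (Pwalk o) n)%E = (u n / r n)%:E.
  near=> n; have r1 : 1 <= r n by near: n; exact: r_ge.
  by rewrite uE rE inver gt_eqF ?(lt_le_trans ltr01).
apply: (@cvg_trans _ ((u n / r n)%:E @[n --> \oo])).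
  by apply: near_eq_cvg; near do apply/esym.
apply: cvg_EFin; first by near=> n.
apply/cvgrPdist_le => eps eps0; have eps20 : 0 < eps / 2 by rewrite divr_gt0.
have [M UM] := UP _ eps20.
near=> n; have r1 : 1 <= r n by near: n; exact: r_ge.
(* This makes [M] at most [r n * (eps / 2)], so that [u n] is at most [r n * (1 + eps)]. *)
have rM : M / (eps / 2) <= r n by near: n; exact: r_ge.
have r0 : 0 < r n := lt_le_trans ltr01 r1.
have ru : r n <= u n by rewrite -lee_fin -rE -uE.
have urM : u n <= r n + M + r n * (eps / 2).
  by rewrite -lee_fin -uE !EFinD EFinM -rE.
rewrite distrC ger0_norm ?subr_ge0 ?ler_pdivlMr ?mul1r//.
rewrite lerBlDl ler_pdivrMr// (le_trans urM)//.
rewrite ler_pdivrMr// in rM; lra.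
Unshelve. all: by end_near.
Qed.
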